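(* In the constant-power network, let $\theta>0$ be a constant and $\epsilon''_\theta=\sqrt{\frac{3\theta\ln m}{E[C_0]}}$, where $E[C_0]=m\bar C$. Then, for $n$ sufficiently large, $$\Pr\big(C_{s,\mathcal T}\le(1+\epsilon''_\theta)E[C_0]\big)=1-O\Big(\frac{1}{m^{\theta}}\Big)$$ as $m\to\infty$.
   Context: Model: nodes $1,\dots,n$ have locations i.i.d. uniform on the two-dimensional unit torus; $d_{ij}$ is the distance between nodes $i$ and $j$. The attenuation function $L:[0,\infty)\to[0,1]$ is continuous and strictly decreasing. Noise $N_0>0$, threshold $\beta>0$, interference factor $\gamma\in[0,1]$; all nodes transmit with constant power $P_0>\beta N_0$. The SINR of link $(i,j)$ is $\beta_{ij}=\frac{L(d_{ij})}{N_0/P_0+\gamma\sum_{k\neq i,j}L(d_{kj})}$ and the link capacity is $C_{ij}=R$ if $\beta_{ij}\ge\beta$, else $0$, for a constant $0<R\le1$. Fix distinct nodes: a source $s$, destinations $\mathcal T=\{t_1,\dots,t_l\}$, relays $u_1,\dots,u_m$, with no direct links considered between $s$ and the destinations. For $t\in\mathcal T$, an $s$-$t$-cut of size $k$ ($0\le k\le m$) is a partition of the relays into $V_k$ ($|V_k|=k$) and $V_k^c$ ($|V_k^c|=m-k$), with capacity $C_k=\sum_{u_i\in V_k^c}C_{s u_i}+\sum_{u_j\in V_k}\sum_{u_i\in V_k^c}C_{u_j u_i}+\sum_{u_j\in V_k}C_{u_j t}$. $C_{s,t}$ is the minimum of $C_k$ over all $s$-$t$-cuts of all sizes, and the network coding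 capacity is $C_{s,\mathcal T}=\min_{t\in\mathcal T}C_{s,t}$. $\bar C=E[C_{ij}]$ ($i\ne j$, expectation over locations), so $E[C_k]=[m+k(m-k)]\bar C$ and $E[C_0]=m\bar C$. *)

(* Defs.v *)
From HB Require Import structures.
From mathcomp Require Import all_boot all_order all_algebra.
From mathcomp Require Import all_classical all_reals all_analysis.
Unset Printing Implicit Defensive.
Import Order.TTheory GRing.Theory Num.Theory.
Import numFieldNormedType.Exports.
Local Open Scope classical_set_scope.
Local Open Scope ring_scope.

Section Network.
Variable R : realType.

(* Node labelling convention (nodes are 0, ..., n-1):
   source s = node 0, destinations t_k = node k.+1 (k < l),
   relays u_i = node (l + 1 + i) (i < m); all other nodes are
   further (interfering) nodes. *)
Definition src : nat := 0.
Definition dest (k : nat) : nat := k.+1.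
Definition relay (l i : nat) : nat := (l + 1 + i)%N.

(* distance along one coordinate of the unit circle R/Z, for a, b in [0,1] *)
Definition tdiff (a b : R) : R := Num.min `|a - b| (1 - `|a - b|).

Definition tdist (x y : nat -> R) (i j : nat) : R :=
  Num.sqrt (tdiff (x i) (x j) ^+ 2 + tdiff (y i) (y j) ^+ 2).

Definition sinr (L : R -> R) (N0 P0 gam : R) (n : nat) (x y : nat -> R)
    (i j : nat) : R :=
  L (tdist x y i j) /
  (N0 / P0 + gam * \sum_(k < n | (k != i :> nat) && (k != j :> nat))
                      L (tdist x y k j)).

Definition cap (L : R -> R) (N0 P0 gam beta Rc : R) (n : nat)
    (x y : nat -> R) (i j : nat) : R :=
  if beta <= sinr L N0 P0 gam n x y i j then Rc else 0.

Definition cut_cap (L : R -> R) (N0 P0 gam beta Rc : R) (n l m : nat)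
    (x y : nat -> R) (t : nat) (V : {set 'I_m}) : R :=
  let C := cap L N0 P0 gam beta Rc n x y in
  \sum_(i in ~: V) C src (relay l i)
  + \sum_(j in V) \sum_(i in ~: V) C (relay l j) (relay l i)
  + \sum_(j in V) C (relay l j) t.

Definition C0 (L : R -> R) (N0 P0 gam beta Rc : R) (n l m : nat)
    (x y : nat -> R) : R :=
  \sum_(i < m) cap L N0 P0 gam beta Rc n x y src (relay l i).

(* C_{s,t}: minimum over all s-t-cuts (of all sizes); the neutral element is
   the capacity of the cut V = set0, itself a member of the family *)
Definition Cst (L : R -> R) (N0 P0 gam beta Rc : R) (n l m : nat)
    (x y : nat -> R) (t : nat) : R :=
  \big[Num.min/cut_cap L N0 P0 gam beta Rc n l m x y t (@finset.set0 _)]_(V : {set 'I_m})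
     cut_cap L N0 P0 gam beta Rc n l m x y t V.

(* network coding capacity C_{s,T} = min over the l destinations (l >= 1) *)
Definition CsT (L : R -> R) (N0 P0 gam beta Rc : R) (n l m : nat)
    (x y : nat -> R) : R :=
  \big[Num.min/Cst L N0 P0 gam beta Rc n l m x y (dest 0)]_(k < l)
     Cst L N0 P0 gam beta Rc n l m x y (dest k).

End Network.

Definition mutually_indep {d} {T : measurableType d} {R : realType}
    (P : probability T R) (n : nat) (X Y : nat -> T -> R) : Prop :=
  forall A B : nat -> set R, (forall i, measurable (A i)) -> (forall i, measurable (B i)) ->
  P (\big[setI/setT]_(i < n) (X i @^-1` A i `&` Y i @^-1` B i)) =
  (\prod_(i < n) (P (X i @^-1` A i) * P (Y i @^-1` B i)))%E.

Definition uniform01 {d} {T : measurableType d} {R : realType}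
    (P : probability T R) (X : T -> R) : Prop :=
  measurable_fun setT X /\
  forall A : set R, measurable A ->
    P (X @^-1` A) = (@lebesgue_measure R) (A `&` `[0%R, 1%R]).

Arguments tdiff {R}. Arguments tdist {R}. Arguments sinr {R}. Arguments cap {R}.
Arguments cut_cap {R}. Arguments C0 {R}. Arguments Cst {R}. Arguments CsT {R}.

(* Main.v *)
Require Import Defs.
From HB Require Import structures.
From mathcomp Require Import all_boot all_order all_algebra.
From mathcomp Require Import all_classical all_reals all_analysis.
From mathcomp Require Import measurable_realfun ring lra.
Import Order.TTheory GRing.Theory Num.Theory.
Import numFieldNormedType.Exports.
Local Open Scope classical_set_scope.
Local Open Scope ring_scope.

(** The cut with no relay on the source side shows [C_{s,T} <= C_0], so it is
    enough to bound the upper tail of [C_0].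

    If [gamma > 0], distances on the torus are at most 1 and [L 1 > 0], so every
    interference sum is almost surely at least [(n - 2) L 1]; once [n] is large
    no link reaches the threshold and [C_0 = 0] almost surely.

    If [gamma = 0], the link [(s, u_i)] is up exactly when [d(s, u_i)] lies in a
    fixed set. By rotation invariance of the torus, the probability [p] of this
    given the location of [s] does not depend on that location, hence the link
    events are mutually independent with probability [p], although they share
    [s]. Thus [C_0 / R] is binomial, and the Chernoff bound at parameter
    [t = epsilon] gives [exp (- m p epsilon^2 / 3) = m^(- theta / R)]. *)

(** * Independence *)

Section independence.
Local Open Scope ereal_scope.

(** Uniqueness of the product measure, applied to the law of [(Z1, Z2)] under [P] restricted to [G].
    Full sets for [A] and [B] force [c = P G], so [c] is finite and nonnegative and may scale
    [mu1]. *)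
Lemma pair_law {d d1 d2} {T : measurableType d} {T1 : measurableType d1}
    {T2 : measurableType d2} {R : realType} (P : probability T R)
    (mu1 : probability T1 R) (mu2 : probability T2 R) (G : set T)
    (Z1 : T -> T1) (Z2 : T -> T2) (c : \bar R) :
  measurable G -> measurable_fun setT Z1 -> measurable_fun setT Z2 ->
  (forall A B, measurable A -> measurable B ->
    P (G `&` (Z1 @^-1` A `&` Z2 @^-1` B)) = c * (mu1 A * mu2 B)) ->
  forall C, measurable C ->
    P (G `&` (fun w => (Z1 w, Z2 w)) @^-1` C) = c * (mu1 \x mu2) C.
Proof.
move=> mG mZ1 mZ2 H C mC.
have cE : c = P G.
  have := H _ _ measurableT measurableT.
  by rewrite !preimage_setT !setIT !probability_setT !mule1.
have cfin : c \is a fin_num by rewrite cE fin_num_measure.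
have c0 : (0 <= fine c)%R by rewrite fine_ge0// cE.
have mZ : measurable_fun setT (fun w => (Z1 w, Z2 w)) by exact: measurable_fun_pair.
pose k : {nonneg R} := NngNum c0.
pose Q := [the {measure set _ -> \bar R} of
  pushforward (mrestr P mG) (fun w => (Z1 w, Z2 w))].
have <- : Q mZ C = P (G `&` (fun w => (Z1 w, Z2 w)) @^-1` C).
  by rewrite /Q /= /pushforward /mrestr setIC.
rewrite -(@product_measure_unique _ _ _ _ _
  [the {finite_measure set _ -> \bar R} of mscale k mu1] mu2 (Q mZ))//.
  rewrite /product_measure1 ge0_integral_mscale//= ?fineK//.
  exact: measurable_fun_xsection.
move=> A B mA mB.
by rewrite /Q /= /pushforward /mrestr /mscale /= setIC fineK// -muleA -H.
Qed.

(* The blocks are turned from rectangles into arbitrary measurable sets one at a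
   time, [pair_law] being applied with all other blocks collected in [G]. *)
Lemma indep_coordinates {d d'} {T : measurableType d} {S : measurableType d'} {R : realType}
    (P : probability T R) (mu : probability S R) (n : nat) (X Y : nat -> T -> S) :
  (forall i, (i < n)%N -> measurable_fun setT (X i) /\ measurable_fun setT (Y i)) ->
  (forall A B : nat -> set S, (forall i, measurable (A i)) -> (forall i, measurable (B i)) ->
    P (\big[setI/setT]_(i < n) (X i @^-1` A i `&` Y i @^-1` B i)) =
    \prod_(i < n) (mu (A i) * mu (B i))) ->
  forall C : nat -> set (S * S), (forall i, measurable (C i)) ->
    P (\big[setI/setT]_(i < n) (fun w => (X i w, Y i w)) @^-1` C i) =
    \prod_(i < n) (mu \x mu) (C i).
Proof.
move=> mXY H.
suff main k : (k <= n)%N -> forall C : nat -> set (S * S),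
    (forall i, measurable (C i)) ->
    (forall i, (k <= i)%N -> exists A B, [/\ measurable A, measurable B & C i = A `*` B]) ->
    P (\big[setI/setT]_(i < n) (fun w => (X i w, Y i w)) @^-1` C i) =
    \prod_(i < n) (mu \x mu) (C i).
  (* From [n] on, [C'] is [setT], a rectangle; hence [main] applies at [k = n], where no block that
     matters is required to be a rectangle. *)
  move=> C mC; pose C' i := if (i < n)%N then C i else setT.
  have := main n (leqnn n) C'.
  have E1 : \big[setI/setT]_(i < n) (fun w => (X i w, Y i w)) @^-1` C' i =
     \big[setI/setT]_(i < n) (fun w => (X i w, Y i w)) @^-1` C i.
    by apply: eq_bigr => i _; rewrite /C' ltn_ord.
  have E2 : \prod_(i < n) (mu \x mu) (C' i) = \prod_(i < n) (mu \x mu) (C i).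
    by apply: eq_bigr => i _; rewrite /C' ltn_ord.
  rewrite E1 E2; apply.
    by move=> i; rewrite /C'; case: ifP.
  move=> i ni; exists setT, setT; split => //.
  by rewrite /C' ltnNge ni setXTT.
elim: k => [_ C mC HC|k IH kn C mC HC].
  have /choice[A /choice[B HAB]] i := HC i (leq0n i).
  rewrite (eq_bigr (fun i : 'I_n => X i @^-1` A i `&` Y i @^-1` B i)); last first.
    by move=> i _; have [_ _ ->] := HAB i.
  rewrite H; [|by move=> i; case: (HAB i)|by move=> i; case: (HAB i)].
  apply: eq_bigr => i _; have [mA mB ->] := HAB i.
  by rewrite product_measure1E.
pose j := Ordinal kn.
have mXYi (i : 'I_n) : measurable_fun setT (fun w => (X i w, Y i w)).
  by have [] := mXY i (ltn_ord i) => ? ?; exact: measurable_fun_pair.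
have mpre (i : 'I_n) (D : set (S * S)) : measurable D -> measurable ((fun w => (X i w, Y i w)) @^-1` D).
  by move=> mD; rewrite -[X in measurable X]setTI; exact: mXYi.
rewrite (bigD1 j)//= setIC [RHS](bigD1 j)//= muleC.
have [mXj mYj] := mXY k kn.
apply: pair_law => //.
  by apply: bigsetI_measurable => i _; exact: mpre.
move=> A B mA mB.
pose C' i := if i == k then A `*` B else C i.
have mC' i : measurable (C' i).
  by rewrite /C'; case: ifP => // _; exact: measurableX.
have := IH (ltnW kn) C' mC'.
rewrite (bigD1 j)//= setIC [X in _ = X](bigD1 j)//= muleC.
have -> : C' k = A `*` B by rewrite /C' eqxx.
rewrite product_measure1E//.
have E i : (i != j) -> C' i = C i.
  move=> ij; rewrite /C'; case: eqP => // ik; move: ij.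
  by rewrite -val_eqE/= ik eqxx.
rewrite (eq_bigr (fun i : 'I_n => (fun w => (X i w, Y i w)) @^-1` C i)); last first.
  by move=> i ij; rewrite E.
rewrite [in X in _ = X](eq_bigr (fun i : 'I_n => (mu \x mu) (C i))); last first.
  by move=> i ij; rewrite E.
apply => i ki; rewrite /C'; case: eqP => [_|/eqP ik]; first by exists A, B.
by apply: HC; rewrite ltn_neqAle eq_sym ik.
Qed.

(** The product measure integrates the measures of the sections; over [A] these equal the constant
    [p] almost everywhere. The factor [A] is what lets an event on the first coordinate survive the
    induction in [indep_common_source]. *)
Lemma product_measure_ae_section {d1 d2} {T1 : measurableType d1} {T2 : measurableType d2}
    {R : realType} (mu1 : probability T1 R) (mu2 : probability T2 R)
    (D : set (T1 * T2)) (A : set T1) (p : \bar R) :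
  measurable D -> measurable A -> {ae mu1, forall z, mu2 (xsection D z) = p} ->
  (mu1 \x mu2) (D `&` A `*` setT) = mu1 A * p.
Proof.
move=> mD mA Dp.
(* A negative [p] would differ from every section measure, and the null set [N] would then be the
   whole space. *)
have p0 : 0 <= p.
  apply: contrapT => /negP; rewrite -ltNge => p0.
  case: Dp => N [mN N0 sN].
  have : mu1 setT <= mu1 N.
    apply: le_measure; rewrite ?inE//.
    by move=> z _; apply: sN => /= Ez; move: p0; rewrite -Ez ltNge measure_ge0.
  by rewrite probability_setT N0 lee_fin ler10.
have mAT : measurable (A `*` @setT T2) by exact: measurableX.
rewrite /product_measure1 (eq_integral (fun z => (\1_A z)%:E * mu2 (xsection D z))); last first.
  move=> z _ /=; rewrite xsectionI indicE.
  have [zA|zA] := boolP (z \in A); first by rewrite in_xsectionX// setIT mul1e.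
  by rewrite notin_xsectionX// setI0 measure0 mul0e.
rewrite (@ge0_ae_eq_integral _ _ _ mu1 setT _ (fun z => (\1_A z)%:E * p))//.
- rewrite ge0_integralZr//; last exact/measurable_EFinP.
  by rewrite integral_indic ?setIT.
- apply: emeasurable_funM; first exact/measurable_EFinP.
  exact: measurable_fun_xsection.
- by apply: emeasurable_funM => //; exact/measurable_EFinP.
- by move=> z _; rewrite mule_ge0 ?lee_fin.
- by move=> z _; rewrite mule_ge0 ?lee_fin.
- by apply: filterS Dp => z /= -> _.
Qed.

(* Same replacement scheme: the event [D i] is allowed to depend on [Z] for one
   more index [i] at each step, while an event on [Z] alone is kept in the
   induction hypothesis. *)
Lemma indep_common_source {d d'} {T : measurableType d} {S : measurableType d'} {R : realType}
    (P : probability T R) (mu : probability S R) (m : nat) (Z : T -> S) (W : nat -> T -> S) :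
  measurable_fun setT Z -> (forall i, (i < m)%N -> measurable_fun setT (W i)) ->
  (forall A (B : nat -> set S), measurable A -> (forall i, measurable (B i)) ->
    P (Z @^-1` A `&` \big[setI/setT]_(i < m) (W i @^-1` B i)) =
    mu A * \prod_(i < m) mu (B i)) ->
  forall (D : nat -> set (S * S)) (p : nat -> \bar R),
    (forall i, measurable (D i)) ->
    (forall i, {ae mu, forall z, mu (xsection (D i) z) = p i}) ->
    P (\big[setI/setT]_(i < m) (fun w => (Z w, W i w)) @^-1` D i) =
    \prod_(i < m) p i.
Proof.
move=> mZ mW H.
suff main k : (k <= m)%N -> forall (D : nat -> set (S * S)) (p : nat -> \bar R) A,
    measurable A -> (forall i, measurable (D i)) ->
    (forall i, {ae mu, forall z, mu (xsection (D i) z) = p i}) ->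
    (forall i, (k <= i)%N -> exists B, [/\ measurable B, D i = setT `*` B & p i = mu B]) ->
    P (Z @^-1` A `&` \big[setI/setT]_(i < m) (fun w => (Z w, W i w)) @^-1` D i) =
    mu A * \prod_(i < m) p i.
  move=> D p mD Dp.
  pose D' i := if (i < m)%N then D i else setT.
  pose p' i := if (i < m)%N then p i else 1.
  have E1 : \big[setI/setT]_(i < m) (fun w => (Z w, W i w)) @^-1` D' i =
     \big[setI/setT]_(i < m) (fun w => (Z w, W i w)) @^-1` D i.
    by apply: eq_bigr => i _; rewrite /D' ltn_ord.
  have E2 : \prod_(i < m) p' i = \prod_(i < m) p i.
    by apply: eq_bigr => i _; rewrite /p' ltn_ord.
  have := main m (leqnn m) D' p' _ measurableT.
  rewrite preimage_setT setTI E1 E2 probability_setT mul1e; apply.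
  - by move=> i; rewrite /D'; case: ifP.
  - move=> i; rewrite /D' /p'; case: ifP => // _.
    by apply: nearW => z; rewrite -setXTT in_xsectionX ?inE// probability_setT.
  - move=> i mi; exists setT; split => //; rewrite /D' /p' ltnNge mi/=.
      by rewrite setXTT.
    by rewrite probability_setT.
elim: k => [_ D p A mA mD Dp HD|k IH km D p A mA mD Dp HD].
  have /choice[B HB] i := HD i (leq0n i).
  rewrite (eq_bigr (fun i : 'I_m => W i @^-1` B i)); last first.
    move=> i _; have [_ -> _] := HB i.
    by apply/seteqP; split => w //= [].
  rewrite H//; last by move=> i; case: (HB i).
  by congr (_ * _); apply: eq_bigr => i _; have [_ _ ->] := HB i.
pose j := Ordinal km.
have mpre (i : 'I_m) (C : set (S * S)) :
    measurable C -> measurable ((fun w => (Z w, W i w)) @^-1` C).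
  move=> mC; rewrite -[X in measurable X]setTI.
  by apply: measurable_fun_pair => //; exact: mW.
pose G := \big[setI/setT]_(i < m | i != j) (fun w => (Z w, W i w)) @^-1` D i.
have mG : measurable G by apply: bigsetI_measurable => i _; exact: mpre.
rewrite (bigD1 j)//= -/G.
(* The event on [Z] is merged into block [k] as the rectangle [A * setT], so that [pair_law] sees
   only the pair [(Z, W k)] against [G]. *)
rewrite [X in P X](_ : _ = G `&` (fun w => (Z w, W k w)) @^-1` (D k `&` A `*` setT)); last first.
  by apply/seteqP; split => w /=; tauto.
rewrite (@pair_law _ _ _ _ _ _ _ _ mu mu _ _ _ (\prod_(i < m | i != j) p i))//.
- rewrite (product_measure_ae_section mu mu (D k) A (p k)); [|exact: mD|exact: mA|exact: Dp].
  by rewrite muleC -muleA; congr (_ * _); rewrite [RHS](bigD1 j).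
- exact: mW.
- move=> A' B mA' mB.
  (* On rectangles the induction hypothesis suffices: [A'] becomes the event on [Z], and block [k]
     constrains [W k] alone. *)
  pose D' i := if i == k then setT `*` B else D i.
  pose p' i := if i == k then mu B else p i.
  have D'E (i : 'I_m) : i != j -> D' i = D i.
    move=> ij; rewrite /D'; case: eqP => // ik; move: ij.
    by rewrite -val_eqE/= ik eqxx.
  have p'E (i : 'I_m) : i != j -> p' i = p i.
    move=> ij; rewrite /p'; case: eqP => // ik; move: ij.
    by rewrite -val_eqE/= ik eqxx.
  have := IH (ltnW km) D' p' _ mA'.
  rewrite (bigD1 j)//= [X in _ = _ * X](bigD1 j)//=.
  rewrite (eq_bigr (fun i : 'I_m => (fun w => (Z w, W i w)) @^-1` D i)); last first.
    by move=> i ij; rewrite D'E.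
  rewrite [in X in _ = X](eq_bigr (fun i : 'I_m => p i)); last first.
    by move=> i ij; rewrite p'E.
  rewrite -/G [D' k]/D' [p' k]/p' eqxx => IH'.
  rewrite muleC -muleA -IH'.
  + by congr (P _); apply/seteqP; split => w /=; tauto.
  + by move=> i; rewrite /D'; case: ifP => // _; exact: measurableX.
  + move=> i; rewrite /D' /p'; case: ifP => // _.
    by apply: nearW => z; rewrite in_xsectionX// inE.
  + move=> i ki; rewrite /D' /p'; case: eqP => [_|/eqP ik]; first by exists B.
    by apply: HD; rewrite ltn_neqAle eq_sym ik.
- exact: measurableI (mD k) (measurableX mA measurableT).
Qed.

End independence.

(** * Uniform distribution on the torus *)

Section torus.
Local Open Scope ereal_scope.

Lemma uniform_prob01E {R : realType} (A : set R) : measurable A ->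
  uniform_prob (@ltr01 R) A = lebesgue_measure (A `&` `[0%R, 1%R]).
Proof.
move=> mA; rewrite /uniform_prob integral_uniform_pdf.
rewrite (eq_integral (cst 1)); last first.
  move=> x; rewrite inE/= => -[_]; rewrite in_itv/= /uniform_pdf => ->.
  by rewrite subr0 invr1.
by rewrite integral_cst ?mul1e//; exact: measurableI.
Qed.

Lemma lebesgue_measure_shift {R : realType} (c : R) (A : set R) : measurable A ->
  lebesgue_measure ((fun x => x + c)%R @^-1` A) = lebesgue_measure A.
Proof.
move=> mA; have mc : measurable_fun setT (fun x : measurableTypeR R => (x + c)%R : measurableTypeR R).
  exact: measurable_funD.
pose Q := [the {measure set (measurableTypeR R) -> \bar R} of
  pushforward (@lebesgue_measure R)
    (fun x : measurableTypeR R => (x + c)%R : measurableTypeR R)].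
transitivity (Q mc A) => //; apply/esym.
have := @lebesgue_measure_unique R (Q mc) _ A mA; apply=> _ [[a b]] _ <-.
rewrite /Q /= /pushforward.
have -> : (fun x : R => x + c)%R @^-1` `]a, b] = `](a - c)%R, (b - c)%R]%classic.
  by apply/seteqP; split => x /=; rewrite !in_itv/= ltrBlDr lerBrDr.
by rewrite !lebesgue_measure_itv/= !lte_fin ltrD2r -!EFinB; case: ifP => // _; congr (_%:E); ring.
Qed.

Lemma measurable_tdiff {d} {T : measurableType d} {R : realType} (f g : T -> R) :
  measurable_fun setT f -> measurable_fun setT g ->
  measurable_fun setT (fun w => tdiff (f w) (g w)).
Proof.
move=> mf mg; have mn : measurable_fun setT (fun w => `|f w - g w|%R).
  by apply: measurableT_comp => //; exact: measurable_funB.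
by apply: measurable_minr => //; exact: measurable_funB.
Qed.

(** Without the endpoint [1] the circle is a half-open interval, which a rotation cuts into two
    disjoint half-open pieces. *)
Lemma uniform_prob_itvco {R : realType} (A : set R) : measurable A ->
  uniform_prob (@ltr01 R) A = lebesgue_measure (A `&` `[0%R, 1%R[).
Proof.
move=> mA; rewrite uniform_prob01E//.
rewrite (_ : `[0%R, 1%R] = `[0%R, 1%R[ `|` [set 1%R])%classic; last first.
  by rewrite setUitv1//= bnd_simp.
rewrite setIUr measureU//; try exact: measurableI.
  rewrite [X in _ + X](_ : _ = 0) ?adde0//.
  apply/eqP; rewrite eq_le measure_ge0 andbT -(@lebesgue_measure_set1 R 1%R).
  by rewrite le_measure// inE; [exact: measurableI | exact: measurable_set1].
by apply/seteqP; split => x //= [[_ +] [_ x1]]; rewrite x1 in_itv/= ltxx andbF.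
Qed.

(** The rotation taking [x] to [0] preserves circle distances and acts on Lebesgue measure as two
    translations. *)
Lemma uniform_prob_tdiff {R : realType} (x : R) (S : set R) : (0 <= x <= 1)%R ->
  measurable S ->
  uniform_prob (@ltr01 R) [set y | S (tdiff x y)] =
  uniform_prob (@ltr01 R) [set y | S (tdiff 0%R y)].
Proof.
move=> /andP[x0 x1] mS.
have mB z : measurable [set y | S (tdiff z y)].
  rewrite -[X in measurable X]setTI.
  exact: measurable_tdiff.
have split_itv (c : R) (A : set R) : (0 <= c <= 1)%R -> measurable A ->
    lebesgue_measure (A `&` `[0%R, 1%R[) =
    lebesgue_measure (A `&` `[0%R, c[) + lebesgue_measure (A `&` `[c, 1%R[).
  move=> /andP[c0 c1] mA; rewrite -measureU//; try exact: measurableI.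
    congr (lebesgue_measure _); rewrite -setIUr; congr (_ `&` _).
    apply/seteqP; split => y /=; rewrite !in_itv/=.
      by have [yc|yc] := ltP y c; lra.
    by move=> []/andP[? ?]; lra.
  by apply/seteqP; split => y //= [[_ +] [_]]; rewrite !in_itv/=; lra.
(* The rotation [y |-> y - x mod 1] maps [x, 1[ to [0, 1 - x[ and [0, x[ to
   [1 - x, 1[. *)
rewrite !uniform_prob_itvco// (split_itv x)//; last by rewrite x0.
rewrite [RHS](split_itv (1 - x)%R)//; last by lra.
rewrite addeC; congr (_ + _).
  rewrite -[RHS](lebesgue_measure_shift (- x)%R); last exact: measurableI.
  congr (lebesgue_measure _); apply/seteqP; split => y /=; rewrite !in_itv/=.
    move=> [Sy yx]; split; last by lra.
    by move: Sy; rewrite /tdiff sub0r normrN distrC.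
  move=> [Sy yx]; split; last by lra.
  by move: Sy; rewrite /tdiff sub0r normrN distrC.
rewrite -[RHS](lebesgue_measure_shift (1 - x)%R); last exact: measurableI.
(* On the piece that wraps around, the two arguments of the minimum in [tdiff] trade places. *)
have E (y : R) : (0 <= y < x)%R -> tdiff 0 (y + (1 - x)) = tdiff x y :> R.
  move=> /andP[y0 yx]; rewrite /tdiff sub0r normrN ger0_norm ?gtr0_norm; try lra.
  by rewrite minC; congr Num.min; ring.
congr (lebesgue_measure _); apply/seteqP; split => y /=; rewrite !in_itv/=.
  by move=> [Sy yx]; rewrite E//; split => //; lra.
by move=> [Sy yx]; rewrite E// in Sy; last lra; split => //; lra.
Qed.

(** The law of one node location, carried by the unit square but defined on the whole plane. *)
Definition square_prob {R : realType} : probability _ R :=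
  (uniform_prob (@ltr01 R)) \x (uniform_prob (@ltr01 R)).

Lemma measurable_tdiff_pair {R : realType} (x y : R) (F : set (R * R)) : measurable F ->
  measurable [set p : R * R | F (tdiff x p.1, tdiff y p.2)].
Proof.
move=> mF; rewrite -[X in measurable X]setTI.
have m : measurable_fun setT (fun p : R * R => (tdiff x p.1, tdiff y p.2)).
  by apply: measurable_fun_pair; apply: measurable_tdiff.
exact: m.
Qed.

Lemma product_measure12E {d1 d2} {T1 : measurableType d1} {T2 : measurableType d2}
    {R : realType} (mu1 : probability T1 R) (mu2 : probability T2 R) (A : set (T1 * T2)) :
  measurable A -> (mu1 \x mu2) A = (mu1 \x^ mu2) A.
Proof.
by move=> mA; apply: product_measure_unique => // B C mB mC; rewrite /= product_measure2E.
Qed.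

(** The coordinates are rotated one at a time: [y] inside sections at a fixed first coordinate, then
    [x] inside sections at a fixed second one. The latter needs the other order of integration,
    hence [product_measure12E]. *)
Lemma square_prob_tdiff {R : realType} (x y : R) (F : set (R * R)) :
  (0 <= x <= 1)%R -> (0 <= y <= 1)%R -> measurable F ->
  square_prob [set p | F (tdiff x p.1, tdiff y p.2)] =
  square_prob [set p : R * R | F (tdiff 0%R p.1, tdiff 0%R p.2)].
Proof.
move=> x01 y01 mF.
have mT := fun a b => measurable_tdiff_pair a b F mF.
transitivity (square_prob [set p : R * R | F (tdiff x p.1, tdiff 0%R p.2)]).
  rewrite /square_prob /= /product_measure1; apply: eq_integral => a _ /=.
  have mFa : measurable (xsection F (tdiff x a)) by exact: measurable_xsection.
  have := uniform_prob_tdiff y _ y01 mFa.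
  rewrite !xsectionE; exact.
pose U := [the probability _ R of uniform_prob (@ltr01 R)].
have E1 := product_measure12E U U _ (mT x 0%R).
have E2 := product_measure12E U U _ (mT 0%R 0%R).
apply: (etrans E1); apply: esym; apply: (etrans E2); apply: esym; rewrite {E1 E2}.
rewrite /product_measure2; apply: eq_integral => b _ /=.
have mFb : measurable (ysection F (tdiff 0 b)%R) by exact: measurable_ysection.
have := uniform_prob_tdiff x _ x01 mFb.
rewrite !ysectionE; exact.
Qed.

End torus.

(** * Chernoff bound *)

Section chernoff.
Local Open Scope ereal_scope.

(** The product expands as a sum over subsets [J] of [a ^+ #|J|] times the indicator of the
    intersection over [J]. Integration replaces each indicator by [p ^+ #|J|], and the same
    expansion read backwards gives the power. *)
Lemma integral_prod_indic {d} {T : measurableType d} {R : realType} (P : probability T R)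
    (m : nat) (E : 'I_m -> set T) (p a : R) : (0 <= a)%R ->
  (forall i, measurable (E i)) ->
  (forall J : {set 'I_m}, P (\big[setI/setT]_(i in J) E i) = (p ^+ #|J|)%:E) ->
  \int[P]_w (\prod_(i < m) (1 + a * \1_(E i) w))%:E = ((1 + a * p) ^+ m)%:E.
Proof.
move=> a0 mE PE.
have mEJ (J : {set 'I_m}) : measurable (\big[setI/setT]_(i in J) E i).
  by apply: bigsetI_measurable => i _.
transitivity (\int[P]_w \sum_(J in {set 'I_m})
    ((a ^+ #|J|) * \1_(\big[setI/setT]_(i in J) E i) w)%:E).
  apply: eq_integral => w _; rewrite sumEFin; congr (_%:E).
  under eq_bigr do rewrite addrC.
  rewrite bigA_distr; apply: eq_bigr => J _.
  rewrite -big_mkcond/= big_split/= prodr_const; congr (_ * _)%R.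
  by rewrite (big_morph (fun A => \1_A w : R) (id1 := 1%R) (op1 := *%R)) ?indicT// => A B; rewrite indicI.
rewrite ge0_integral_sum//; last 2 first.
- move=> J; apply/measurable_EFinP; apply: measurable_funM => //.
- by move=> J w _; rewrite lee_fin mulr_ge0 ?exprn_ge0.
transitivity (\sum_(J in {set 'I_m}) ((a * p) ^+ #|J|)%:E).
  apply: eq_bigr => J _.
  under eq_integral do rewrite EFinM.
  rewrite ge0_integralZl//; [|exact/measurable_EFinP|by rewrite lee_fin exprn_ge0].
  by rewrite integral_indic// setIT exprMn EFinM; congr (_ * _); exact: PE.
rewrite sumEFin; congr (_%:E).
rewrite -[in RHS](card_ord m) -prodr_const.
under [RHS]eq_bigr do rewrite addrC.
by rewrite bigA_distr; apply: eq_bigr => J _; rewrite -big_mkcond/= prodr_const.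
Qed.

(** An indicator takes only the values 0 and 1, so [expR (t * \1_E)] is [1 + (expR t - 1) * \1_E].
    The moment generating function is thus the integral of [integral_prod_indic] at
    [a = expR t - 1]. *)
Lemma chernoff_indep_events {d} {T : measurableType d} {R : realType} (P : probability T R)
    (m : nat) (E : 'I_m -> set T) (p t s : R) : (0 < t)%R ->
  (forall i, measurable (E i)) ->
  (forall J : {set 'I_m}, P (\big[setI/setT]_(i in J) E i) = (p ^+ #|J|)%:E) ->
  P [set w | (s <= \sum_(i < m) \1_(E i) w)%R] <=
  ((1 + (expR t - 1) * p) ^+ m * expR (- (t * s)))%:E.
Proof.
move=> t0 mE PE.
have mX : measurable_fun setT (fun w => \sum_(i < m) \1_(E i) w : R)%R.
  by apply: measurable_sum => i; exact: measurable_indic.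
pose X : {RV P >-> R} := mfun_Sub (mem_set mX).
have HC := @chernoff _ _ _ P X t s t0. apply: (le_trans HC).
rewrite EFinM /mmt_gen_fun unlock -(@integral_prod_indic _ _ _ P m E p)//; last first.
  by rewrite subr_ge0 -expR0 ler_expR ltW.
rewrite le_eqVlt; apply/orP; left; apply/eqP; congr (_ * _); apply: eq_integral => w _ /=; congr (_%:E).
rewrite mulr_suml expR_sum; apply: eq_bigr => i _.
by rewrite indicE; case: (w \in E i); rewrite ?mul1r ?mul0r ?mulr1 ?mulr0 ?expR0 ?addr0// addrC subrK.
Qed.

Lemma expR_le_quadratic {R : realType} (t : R) : (0 <= t <= 1 / 10)%R ->
  (expR t <= 1 + t + 2 / 3 * t ^+ 2)%R.
Proof.
move=> /andP[t0 t1].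
have h : (0 < 1 - t / 4)%R by lra.
(* [exp t <= (1 - t/4)^-4]; the power 4 brings the second-order coefficient
   down to 5/8 < 2/3. *)
have h4 : ((1 - t / 4) ^+ 4 <= expR (- t))%R.
  have -> : (- t = 4%:R * (- (t / 4)))%R by field.
  by rewrite expRM_natl lerXn2r ?nnegrE ?expR_ge0 ?(ltW h)// expR_ge1Dx.
have -> : expR t = (expR (- t))^-1%R by rewrite expRN invrK.
have q0 : (0 < (1 - t / 4) ^+ 4)%R by rewrite exprn_gt0.
apply: (@le_trans _ _ ((1 - t / 4) ^+ 4)^-1%R).
  by rewrite lef_pV2 ?posrE ?expR_gt0.
rewrite -div1r ler_pdivrMr//.
rewrite -subr_ge0.
(* The constant [1 / 24] is [2 / 3 - 5 / 8]; for [t <= 1 / 10] it outweighs [17 / 48 * t], and the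
   remaining terms are jointly nonnegative. *)
have -> : ((1 + t + 2 / 3 * t ^+ 2) * (1 - t / 4) ^+ 4 - 1 =
  t ^+ 2 * (1 / 24 - 17 / 48 * t + 49/256 * t ^+ 2 - 29/768 * t ^+ 3 + t ^+ 4 / 384))%R.
  by field.
apply: mulr_ge0; first exact: sqr_ge0.
have a1 : (0 <= t ^+ 2 * (49 / 256 - 29 / 768 * t))%R by apply: mulr_ge0; [exact: sqr_ge0|lra].
have a2 : (0 <= t ^+ 4)%R by rewrite exprn_ge0.
have a3 : (t ^+ 2 * (49 / 256 - 29 / 768 * t) = 49 / 256 * t ^+ 2 - 29 / 768 * t ^+ 3)%R by ring.
lra.
Qed.

(** After [1 + u <= expR u], the gain per unit of [m p] is at least
    [e * (1 + e) - (e + 2 / 3 * e ^+ 2)], which is [e ^+ 2 / 3]. *)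
Lemma chernoff_exponent {R : realType} (m : nat) (p e : R) :
  (0 <= p)%R -> (0 <= e <= 1 / 10)%R ->
  ((1 + (expR e - 1) * p) ^+ m * expR (- (e * ((1 + e) * (m%:R * p)))) <=
   expR (- (m%:R * p * e ^+ 2 / 3)))%R.
Proof.
move=> p0 e01; have /andP[e0 e1] := e01.
have h := expR_le_quadratic e e01.
have eb : (0 <= expR e - 1)%R by rewrite subr_ge0 -expR0 ler_expR.
apply: (@le_trans _ _ (expR ((expR e - 1) * p * m%:R) * expR (- (e * ((1 + e) * (m%:R * p)))))%R).
  rewrite ler_wpM2r ?expR_ge0// [(_ * m%:R)%R]mulrC expRM_natl.
  by rewrite lerXn2r ?nnegrE ?expR_ge0 ?addr_ge0 ?mulr_ge0// expR_ge1Dx.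
rewrite -expRD ler_expR -subr_ge0.
have -> : (- (m%:R * p * e ^+ 2 / 3) - ((expR e - 1) * p * m%:R - e * ((1 + e) * (m%:R * p))) =
  (m%:R * p) * (1 + e + 2 / 3 * e ^+ 2 - expR e))%R by field.
by rewrite mulr_ge0 ?subr_ge0// mulr_ge0.
Qed.

End chernoff.

(** * Upper tail of a scaled sum of independent indicators *)

Lemma measurable_is_true {d} {T : measurableType d} (b : T -> bool) :
  measurable_fun setT b -> measurable [set w | b w].
Proof. by move=> mb; rewrite -[X in measurable X]setTI; exact: (mb measurableT [set true]). Qed.

(** Square [s <= 1 + s <= expR s] at [s = Num.sqrt x]. *)
Lemma ln_le_sqrt {R : realType} (x : R) : 0 < x -> ln x <= 2 * Num.sqrt x.
Proof.
move=> x0; have s0 : 0 <= Num.sqrt x by exact: sqrtr_ge0.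
rewrite -ler_expR lnK ?posrE// expRM_natl -[leLHS](sqr_sqrtr (ltW x0)).
rewrite lerXn2r ?nnegrE ?expR_ge0//.
by apply: le_trans (expR_ge1Dx _); lra.
Qed.

Lemma expectation_sum_indic {d} {T : measurableType d} {R : realType} (P : probability T R)
    (m : nat) (E : 'I_m -> set T) (p c : R) : 0 <= c -> (forall i, measurable (E i)) ->
  (forall i, P (E i) = p%:E) ->
  ('E_P[fun w => (c * \sum_(i < m) \1_(E i) w)%R] = (c * (m%:R * p))%:E)%E.
Proof.
move=> c0 mE PE; rewrite unlock.
under eq_integral do rewrite mulr_sumr -sumEFin.
rewrite ge0_integral_sum//; last 2 first.
- by move=> i; apply/measurable_EFinP; exact: measurable_funM.
- by move=> i w _; rewrite lee_fin mulr_ge0.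
rewrite (eq_bigr (fun=> (c * p)%:E)); last first.
  move=> i _; under eq_integral do rewrite EFinM.
  rewrite ge0_integralZl//; [|exact/measurable_EFinP].
  by rewrite integral_indic// setIT EFinM; congr (_ * _)%E; exact: PE.
by rewrite sumEFin sumr_const card_ord -[in LHS]mulr_natl mulrCA.
Qed.

(** The bound [1 / 100] on [eps ^+ 2] puts [eps] in the range [[0, 1 / 10]] of [chernoff_exponent];
    the parameter of the Chernoff bound is then [eps] itself. *)
Lemma binomial_upper_tail {d} {T : measurableType d} {R : realType} (P : probability T R)
    (m : nat) (E : 'I_m -> set T) (p c theta mu eps : R) :
  mu = c * (m%:R * p) -> eps = Num.sqrt (3 * theta * ln m%:R / mu) ->
  (1 < m)%N -> 0 <= p -> 0 < c <= 1 -> 0 < theta ->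
  (0 < p -> 3 * theta * ln m%:R / (c * (m%:R * p)) <= 1 / 100) ->
  (forall i, measurable (E i)) ->
  (forall J : {set 'I_m}, P (\big[setI/setT]_(i in J) E i) = (p ^+ #|J|)%:E) ->
  (P [set w | ((1 + eps) * mu < c * \sum_(i < m) \1_(E i) w)%R] <= (1 / m%:R `^ theta)%:E)%E.
Proof.
move=> muE epsE m1 p0 /andP[c0 c1] th0 Hp mE PE.
have m0 : 0 < m%:R :> R by rewrite ltr0n ltnW.
have lnm : 0 < ln m%:R :> R by rewrite ln_gt0// ltr1n.
have powE : 1 / m%:R `^ theta = expR (- (theta * ln m%:R)).
  by rewrite /powR gt_eqF// expRN div1r.
have mX : measurable_fun setT (fun w => \sum_(i < m) \1_(E i) w : R).
  by apply: measurable_sum => i; exact: measurable_indic.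
have mle (s : R) : measurable [set w | s <= \sum_(i < m) \1_(E i) w].
  by apply: measurable_is_true; exact: measurable_fun_ler.
have mlt : measurable [set w | (1 + eps) * mu < c * \sum_(i < m) \1_(E i) w].
  apply: measurable_is_true; apply: measurable_fun_ltr => //.
  exact: measurable_funM.
rewrite powE; move: p0; rewrite le_eqVlt => /orP[/eqP p0|p0].
  (* Here [eps] is the junk value [sqrt (_ / 0) = 0]; any [t] is allowed in the
     Chernoff bound, and [t = theta ln m] suffices. *)
  have mu0 : mu = 0 by rewrite muE -p0 !mulr0.
  (* As [mu = 0], the event says that the count is positive; a positive count of events is at least
     1. *)
  apply: (@le_trans _ _ (P [set w | 1 <= \sum_(i < m) \1_(E i) w])).
    apply: le_measure; [by rewrite inE; exact: mlt|by rewrite inE; exact: mle|move=> w /=].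
    rewrite mu0 mulr0 pmulr_rgt0// => /lt0r_neq0; apply: contra_neqT; rewrite -ltNge => h.
    apply: big1 => i _; rewrite indicE; case: (boolP (w \in E i)) => // wi.
    suff : 1 <= \sum_(i < m) \1_(E i) w :> R by rewrite leNgt h.
    by rewrite (bigD1 i)//= indicE wi lerDl sumr_ge0.
  have t0 : 0 < theta * ln m%:R by rewrite mulr_gt0.
  apply: (le_trans (chernoff_indep_events P m E p _ 1 t0 mE PE)).
  by rewrite -p0 mulr0 addr0 expr1n mul1r mulr1.
have mu0 : 0 < mu by rewrite muE !mulr_gt0.
have e2 : eps ^+ 2 = 3 * theta * ln m%:R / mu.
  by rewrite epsE sqr_sqrtr// divr_ge0 ?mulr_ge0// ltW.
have e0 : 0 < eps by rewrite epsE sqrtr_gt0 divr_gt0 ?mulr_gt0.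
have e1 : eps <= 1 / 10.
  have : eps ^+ 2 <= 1 / 100 by rewrite e2 muE; exact: Hp.
  nra.
apply: (@le_trans _ _ (P [set w | (1 + eps) * (m%:R * p) <= \sum_(i < m) \1_(E i) w])).
  apply: le_measure; [by rewrite inE; exact: mlt|by rewrite inE; exact: mle|move=> w /=].
  by rewrite muE mulrCA ltr_pM2l// => /ltW.
apply: (le_trans (chernoff_indep_events P m E p _ _ e0 mE PE)).
rewrite lee_fin; apply: le_trans (chernoff_exponent m p eps (ltW p0) _) _.
  by rewrite ltW.
(* The exponent [m p eps ^+ 2 / 3] equals [theta * ln m / c], at least [theta * ln m] because
   [c <= 1]. *)
rewrite ler_expR lerN2 e2 muE.
rewrite (_ : m%:R * p * _ / 3 = theta * ln m%:R / c); last first.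
  by field; rewrite !gt_eqF.
by rewrite ler_pdivlMr// ler_piMr// mulr_ge0// ltW.
Qed.

(** With [s = Num.sqrt m] and [ln m <= 2 * s], the ratio is at most [6 * theta / (a * s)], and [s]
    exceeds [600 * theta / a]. *)
Lemma log_ratio_small {R : realType} (a theta : R) (m : nat) :
  0 < a -> 0 < theta -> (600 * theta / a) ^+ 2 < m%:R ->
  3 * theta * ln m%:R / (a * m%:R) <= 1 / 100.
Proof.
move=> a0 th0 hm.
have m0 : 0 < m%:R :> R by apply: le_lt_trans hm; exact: sqr_ge0.
set s : R := Num.sqrt m%:R.
have s0 : 0 < s by rewrite sqrtr_gt0.
have ms : m%:R = s ^+ 2 :> R by rewrite sqr_sqrtr// ltW.
have hs : 600 * theta <= s * a.
  rewrite -ler_pdivrMr//; apply: ltW.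
  have : 0 <= 600 * theta / a by exact: divr_ge0 (mulr_ge0 (ler0n R 600) (ltW th0)) (ltW a0).
  move: hm; rewrite ms; move: (600 * theta / a) => q hm q0.
  by rewrite -(@ltr_pXn2r _ 2)// nnegrE ltW.
have hl : ln m%:R <= 2 * s by exact: ln_le_sqrt.
rewrite ler_pdivrMr; last exact: mulr_gt0.
apply: (@le_trans _ _ (3 * theta * (2 * s))).
  by apply: ler_wpM2l hl; apply: mulr_ge0; [exact: ler0n|exact: ltW].
rewrite ms; have := ler_wpM2r (ltW s0) hs; lra.
Qed.

(** * Network quantities *)

Lemma tdist_ge0 {R : realType} (x y : nat -> R) i j : 0 <= tdist x y i j.
Proof. exact: sqrtr_ge0. Qed.

(** Continuity of [L] is given on the half-line only, so [f] has to take its values there. *)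
Lemma measurable_attenuation {R : realType} (L : R -> R) :
  {within [set x : R | 0 <= x], continuous L} ->
  forall d (T : measurableType d) (f : T -> R), (forall w, 0 <= f w) ->
  measurable_fun setT f -> measurable_fun setT (L \o f).
Proof.
move=> Lc d T f f0 mf.
have mD : measurable [set x : R | 0 <= x].
  by rewrite (_ : [set x | _] = `[0, +oo[%classic)//; apply/seteqP; split => x /=; rewrite in_itv/= andbT.
apply: (measurable_comp mD) => //.
  by move=> _ [w _ <-]; exact: f0.
exact: subspace_continuous_measurable_fun.
Qed.

Lemma measurable_sqrt_fun {d} {T : measurableType d} {R : realType} (f : T -> R) :
  measurable_fun setT f -> measurable_fun setT (fun w => Num.sqrt (f w)).
Proof.
move=> mf; have ms : measurable_fun setT (@Num.sqrt R).
  by apply: continuous_measurable_fun; exact: sqrt_continuous.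
exact: measurableT_comp ms mf.
Qed.

Lemma measurable_tdist {d} {T : measurableType d} {R : realType} (X Y : nat -> T -> R) (i j : nat) :
  measurable_fun setT (X i) -> measurable_fun setT (X j) ->
  measurable_fun setT (Y i) -> measurable_fun setT (Y j) ->
  measurable_fun setT (fun w => tdist (X^~ w) (Y^~ w) i j).
Proof.
move=> mXi mXj mYi mYj; apply: measurable_sqrt_fun.
by apply: measurable_funD; apply: measurable_funX; exact: measurable_tdiff.
Qed.

Section network.
Context {R : realType} (L : R -> R) (N0 P0 gam beta Rc : R).
Hypothesis HLcont : {within [set x : R | 0 <= x], continuous L}.
Hypothesis HLrange : forall a : R, 0 <= a -> 0 <= L a <= 1.
Hypothesis HNP : 0 < N0 / P0.
Hypothesis Hgam : 0 <= gam <= 1.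
Hypothesis HRc : 0 < Rc <= 1.

Lemma measurable_cap {d} {T : measurableType d} (X Y : nat -> T -> R) (n i j : nat) :
  (forall k, (k < n)%N -> measurable_fun setT (X k) /\ measurable_fun setT (Y k)) ->
  (i < n)%N -> (j < n)%N ->
  measurable_fun setT (fun w => cap L N0 P0 gam beta Rc n (X^~ w) (Y^~ w) i j).
Proof.
move=> mXY ni nj.
have mL a b : (a < n)%N -> (b < n)%N -> measurable_fun setT (fun w => L (tdist (X^~ w) (Y^~ w) a b)).
  move=> /mXY[mXa mYa] /mXY[mXb mYb].
  apply: (measurable_attenuation L HLcont) => [w|]; first exact: tdist_ge0.
  exact: measurable_tdist.
apply: measurable_fun_ifT => //.
pose I w := N0 / P0 + gam * \sum_(k < n | (k != i :> nat) && (k != j :> nat)) L (tdist (X^~ w) (Y^~ w) k j).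
have I0 w : 0 < I w.
  apply: ltr_wpDr => //; apply: mulr_ge0; first by case/andP: Hgam.
  by apply: sumr_ge0 => k _; have /andP[] := HLrange _ (tdist_ge0 (X^~ w) (Y^~ w) k j).
(* Clearing the positive denominator turns the SINR test into a comparison of two measurable
   functions, with no quotient. *)
rewrite [X in measurable_fun _ X](_ : _ = fun w => beta * I w <= L (tdist (X^~ w) (Y^~ w) i j)); last first.
  by apply/funext => w; rewrite /sinr (ler_pdivlMr _ _ (I0 w)).
apply: measurable_fun_ler => //; last exact: mL.
apply: measurable_funM => //; apply: measurable_funD => //; apply: measurable_funM => //.
under eq_fun do rewrite big_mkcond/=.
by apply: measurable_sum => k; apply: measurable_fun_ifT => //; exact: mL.
Qed.

Lemma measurable_bigmin {d} {T : measurableType d} (I : Type) (r : seq I) (f0 : T -> R)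
    (f : I -> T -> R) :
  measurable_fun setT f0 -> (forall i, measurable_fun setT (f i)) ->
  measurable_fun setT (fun w => \big[Num.min/f0 w]_(i <- r) f i w).
Proof.
move=> mf0 mf; elim: r => [|i r IH].
  by under eq_fun do rewrite big_nil.
by under eq_fun do rewrite big_cons; exact: measurable_minr.
Qed.

Lemma measurable_CsT {d} {T : measurableType d} (X Y : nat -> T -> R) (n l m : nat) :
  (0 < l)%N -> (l + 1 + m <= n)%N ->
  (forall k, (k < n)%N -> measurable_fun setT (X k) /\ measurable_fun setT (Y k)) ->
  measurable_fun setT (fun w => CsT L N0 P0 gam beta Rc n l m (X^~ w) (Y^~ w)).
Proof.
move=> l0 lmn mXY.
have r_lt (i : 'I_m) : (relay l i < n)%N.
  by apply: leq_trans lmn; rewrite /relay ltn_add2l.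
have s_lt : (src < n)%N by apply: leq_trans lmn; rewrite /src addn1.
have d_lt k : (k < l)%N -> (dest k < n)%N.
  by move=> kl; apply: leq_trans lmn; rewrite /dest addn1 addSn ltnS (leq_trans kl)// leq_addr.
have mcut k (V : {set 'I_m}) : (k < l)%N ->
    measurable_fun setT (fun w => cut_cap L N0 P0 gam beta Rc n l m (X^~ w) (Y^~ w) (dest k) V).
  move=> kl; apply: measurable_funD; first apply: measurable_funD.
  - under eq_fun do rewrite big_mkcond/=.
    by apply: measurable_sum => i; apply: measurable_fun_ifT => //; exact: measurable_cap.
  - under eq_fun do rewrite big_mkcond/=.
    apply: measurable_sum => i; apply: measurable_fun_ifT => //.
    under eq_fun do rewrite big_mkcond/=.
    by apply: measurable_sum => j; apply: measurable_fun_ifT => //; exact: measurable_cap.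
  - under eq_fun do rewrite big_mkcond/=.
    by apply: measurable_sum => i; apply: measurable_fun_ifT => //; apply: measurable_cap => //; exact: d_lt.
have mCst k : (k < l)%N ->
    measurable_fun setT (fun w => Cst L N0 P0 gam beta Rc n l m (X^~ w) (Y^~ w) (dest k)).
  by move=> kl; apply: measurable_bigmin => [|V]; exact: mcut.
by apply: measurable_bigmin => [|k]; exact: mCst.
Qed.

(** A minimum is at most its neutral element: here first the destination [dest 0], then the cut with
    [V] empty, whose last two sums are empty. *)
Lemma CsT_le_C0 (n l m : nat) (x y : nat -> R) :
  CsT L N0 P0 gam beta Rc n l m x y <= C0 L N0 P0 gam beta Rc n l m x y.
Proof.
apply: (le_trans (bigmin_le_id _ _ _ _)); apply: (le_trans (bigmin_le_id _ _ _ _)).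
rewrite /cut_cap [X in _ + X]big1 ?addr0; last by move=> i; rewrite inE.
rewrite [X in _ + X]big1 ?addr0; last by move=> i; rewrite inE.
by rewrite /C0 le_eqVlt; apply/orP; left; apply/eqP/eq_bigl => i; rewrite !inE.
Qed.

Lemma cap_ge0 n x y i j : 0 <= cap L N0 P0 gam beta Rc n x y i j.
Proof. by rewrite /cap; case: ifP => // _; apply: ltW; case/andP: HRc. Qed.

(** A circle distance is at most [1 / 2], so each coordinate adds at most [1 / 4] under the root. *)
Lemma tdist_le1 (x y : nat -> R) i j :
  0 <= x i <= 1 -> 0 <= x j <= 1 -> 0 <= y i <= 1 -> 0 <= y j <= 1 ->
  tdist x y i j <= 1.
Proof.
move=> xi xj yi yj.
have h (a b : R) : 0 <= a <= 1 -> 0 <= b <= 1 -> tdiff a b ^+ 2 <= 1 / 4.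
  move=> a01 b01.
  have : 0 <= tdiff a b <= 1 / 2.
    by rewrite /tdiff minEle; case: ifP; case: (ger0P (a - b)); lra.
  by nra.
rewrite -[leRHS]sqrtr1 ler_wsqrtr//.
have := h _ _ xi xj; have := h _ _ yi yj; lra.
Qed.

Lemma interference_ge (n i j : nat) (x y : nat -> R) :
  (i < n)%N -> (j < n)%N -> i != j ->
  (forall a b : R, 0 <= a -> a < b -> L b < L a) ->
  (forall k, (k < n)%N -> 0 <= x k <= 1 /\ 0 <= y k <= 1) ->
  L 1 * (n - 2)%:R <= \sum_(k < n | (k != i :> nat) && (k != j :> nat)) L (tdist x y k j).
Proof.
move=> ni nj ij HLdec xy.
apply: (@le_trans _ _ (\sum_(k < n | (k != i :> nat) && (k != j :> nat)) L 1)).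
  rewrite sumr_const -[leRHS]mulr_natr.
  have L1 : 0 <= L 1 by have /andP[] := HLrange _ (@ler01 R).
  rewrite ler_wpM2l// ler_nat.
  (* Counting by sums of ones: splitting [i] and [j] off the [n] indices leaves [n - 2]. *)
  rewrite -sum1_card -{1}(card_ord n) -sum1_card (bigD1 (Ordinal ni))//=.
  rewrite (bigD1 (Ordinal nj))/=; last by rewrite -val_eqE/= eq_sym.
  by rewrite addnA addKn.
apply: ler_sum => k _.
have [xk yk] := xy _ (ltn_ord k); have [xj yj] := xy _ nj.
have := tdist_le1 _ _ _ _ xk xj yk yj.
rewrite le_eqVlt => /orP[/eqP -> //|h].
by apply/ltW/HLdec => //; exact: tdist_ge0.
Qed.

(** The signal is at most 1, while [beta] times the interference already exceeds 1; every source
    link is therefore below the threshold. *)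
Lemma C0_eq0 (n l m : nat) (x y : nat -> R) :
  (l + 1 + m <= n)%N ->
  (forall a b : R, 0 <= a -> a < b -> L b < L a) ->
  (forall k, (k < n)%N -> 0 <= x k <= 1 /\ 0 <= y k <= 1) ->
  1 < beta * (gam * (L 1 * (n - 2)%:R)) -> 0 < beta ->
  C0 L N0 P0 gam beta Rc n l m x y = 0.
Proof.
move=> lmn HLdec xy Hn b0.
rewrite /C0 big1// => i _; rewrite /cap; case: ifP => // h; exfalso.
have r_lt : (relay l i < n)%N by apply: leq_trans lmn; rewrite /relay ltn_add2l.
have s_lt : (src < n)%N by apply: leq_ltn_trans r_lt.
have sr : src != relay l i by rewrite /relay addn1.
have := interference_ge n src (relay l i) x y s_lt r_lt sr HLdec xy.
move: h; rewrite /sinr; set S := \sum_(k < n | _) _ => h LS.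
have /andP[g0 g1] := Hgam.
have gS : gam * (L 1 * (n - 2)%:R) <= gam * S by rewrite ler_wpM2l.
have L1 : 0 <= L 1 by have /andP[] := HLrange _ (@ler01 R).
have gS0 : 0 <= gam * (L 1 * (n - 2)%:R) by rewrite !mulr_ge0.
have I0 : 0 < N0 / P0 + gam * S by apply: ltr_wpDr => //; exact: le_trans gS.
move: h; rewrite (ler_pdivlMr _ _ I0).
have /andP[_ LL] := HLrange _ (tdist_ge0 x y src (relay l i)).
apply/negP; rewrite -ltNge; apply: le_lt_trans LL _; apply: lt_le_trans Hn _.
by rewrite (ler_wpM2l (ltW b0))// ler_wpDl// ltW.
Qed.
End network.

(** * Joint law of the source links in the absence of interference *)

Lemma measurable_link {R : realType} (L : R -> R) (b c : R) :
  {within [set x : R | 0 <= x], continuous L} ->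
  measurable [set q : R * R | b <= L (Num.sqrt (q.1 ^+ 2 + q.2 ^+ 2)) / c].
Proof.
move=> Lc.
have mL : measurable_fun setT (L \o (fun q : R * R => Num.sqrt (q.1 ^+ 2 + q.2 ^+ 2))).
  apply: measurable_attenuation => //.
  by apply: measurable_sqrt_fun; apply: measurable_funD; apply: measurable_funX.
by apply: measurable_is_true; apply: measurable_fun_ler => //; exact: measurable_funM.
Qed.

(** The labels run through the source, the destinations, the relays and the other nodes; the second
    and fourth groups contribute [idx]. It serves both for intersections of events and for products
    of probabilities. *)
Lemma big_source_relays {I : Type} (idx : I) (op : Monoid.law idx) (f : nat -> I) (l m n : nat) :
  (l + 1 + m <= n)%N -> (forall i, (0 < i < l + 1)%N -> f i = idx) ->
  (forall i, (l + 1 + m <= i)%N -> f i = idx) ->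
  \big[op/idx]_(i < n) f i = op (f src) (\big[op/idx]_(i < m) f (relay l i)).
Proof.
move=> lmn f1 f2.
rewrite -(big_mkord xpredT) (@big_cat_nat _ _ _ (l + 1 + m)%N)//=.
rewrite [X in op _ X]big_nat_cond [X in op _ X]big1 ?Monoid.mulm1; last first.
  by move=> i /andP[/andP[? _] _]; exact: f2.
rewrite (@big_cat_nat _ _ _ (l + 1)%N)//=; last exact: leq_addr.
congr (op _ _).
  rewrite addn1 big_nat_recl//= [X in op _ X]big_nat_cond [X in op _ X]big1 ?Monoid.mulm1//.
  by move=> i /andP[/andP[_ il] _]; apply: f1; rewrite addn1 ltnS.
by rewrite -{1}[(l + 1)%N]add0n big_addn addKn big_mkord; apply: eq_bigr => i _; rewrite addnC.
Qed.

Section unit_square.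
Local Open Scope ereal_scope.
Context {d} {T : measurableType d} {R : realType} (P : probability T R) (X Y : nat -> T -> R).

(** [uniform01] prescribes a law only, so coordinates may leave [[0, 1]] on a null set; this is the
    almost sure event on which the distance bounds hold. *)
Lemma uniform_in_square (n : nat) :
  (forall i, (i < n)%N -> uniform01 P (X i) /\ uniform01 P (Y i)) ->
  mutually_indep P n X Y ->
  P (\big[setI/setT]_(i < n) (X i @^-1` `[0%R, 1%R] `&` Y i @^-1` `[0%R, 1%R])) = 1.
Proof.
move=> hu /(_ (fun=> `[0%R, 1%R]%classic) (fun=> `[0%R, 1%R]%classic)) ->//.
rewrite big1// => i _; have [[_ hX] [_ hY]] := hu i (ltn_ord i).
rewrite hX ?hY//; rewrite setIid lebesgue_measure_itv/= lte_fin ltr01.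
by rewrite -EFinB subr0 mul1e.
Qed.

Lemma indep_source_relays (l m n : nat) : (l + 1 + m <= n)%N ->
  (forall i, (i < n)%N -> uniform01 P (X i) /\ uniform01 P (Y i)) ->
  mutually_indep P n X Y ->
  forall (A : set (R * R)) (B : nat -> set (R * R)), measurable A -> (forall i, measurable (B i)) ->
    P ((fun w => (X src w, Y src w)) @^-1` A `&`
      \big[setI/setT]_(i < m) ((fun w => (X (relay l i) w, Y (relay l i) w)) @^-1` B i)) =
    square_prob A * \prod_(i < m) square_prob (B i).
Proof.
move=> lmn hu hi A B mA mB.
(* [A] sits at the source and [B i] at relay [i]; all other nodes are unconstrained. *)
pose C k := if k == 0%N then A else
  if (l + 1 <= k < l + 1 + m)%N then B (k - (l + 1))%N else setT.
have mC k : measurable (C k) by rewrite /C; do 2 case: ifP => // _.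
have C1 i : (0 < i < l + 1)%N -> C i = setT.
  move=> /andP[i0 il]; rewrite /C gtn_eqF//; case: ifP => // /andP[+ _].
  by rewrite leqNgt il.
have C2 i : (l + 1 + m <= i)%N -> C i = setT.
  move=> il; rewrite /C gtn_eqF; last by apply: leq_trans il; rewrite addn1.
  by rewrite ltnNge il andbF.
have Cr (i : 'I_m) : C (relay l i) = B i.
  rewrite /C /relay (_ : (l + 1 + i == 0)%N = false); last by rewrite addn1.
  by rewrite leq_addr ltn_add2l ltn_ord/= addKn.
have U01 i : (i < n)%N -> measurable_fun setT (X i) /\ measurable_fun setT (Y i).
  by move=> /hu[[? _] [? _]].
have H (A' B' : nat -> set R) : (forall i, measurable (A' i)) -> (forall i, measurable (B' i)) ->
    P (\big[setI/setT]_(i < n) (X i @^-1` A' i `&` Y i @^-1` B' i)) =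
    \prod_(i < n) (uniform_prob (@ltr01 R) (A' i) * uniform_prob (@ltr01 R) (B' i)).
  move=> mA' mB'; apply: (etrans (hi _ _ mA' mB')); apply: eq_bigr => i _.
  have [[_ hX] [_ hY]] := hu i (ltn_ord i).
  by rewrite !uniform_prob01E//; congr (_ * _); [exact: hX|exact: hY].
have : P (\big[setI/setT]_(i < n) (fun w => (X i w, Y i w)) @^-1` C i) =
    \prod_(i < n) square_prob (C i).
  exact: (indep_coordinates P [the probability _ R of uniform_prob (@ltr01 R)] n X Y U01 H C mC).
rewrite (big_source_relays _ _ (fun i => (fun w => (X i w, Y i w)) @^-1` C i) l m)//; first last.
- by move=> i /C2 ->; rewrite preimage_setT.
- by move=> i /C1 ->; rewrite preimage_setT.
have C1' i : (0 < i < l + 1)%N -> square_prob (C i) = 1.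
  by move=> /C1 ->; rewrite probability_setT.
have C2' i : (l + 1 + m <= i)%N -> square_prob (C i) = 1.
  by move=> /C2 ->; rewrite probability_setT.
rewrite (big_source_relays _ _ (fun i => square_prob (C i)) l m n lmn C1' C2').
have -> : \prod_(i < m) square_prob (C (relay l i)) = \prod_(i < m) square_prob (B i).
  by apply: eq_bigr => i _; rewrite Cr.
have -> : \big[setI/setT]_(i < m) ((fun w => (X (relay l i) w, Y (relay l i) w)) @^-1` C (relay l i)) =
    \big[setI/setT]_(i < m) ((fun w => (X (relay l i) w, Y (relay l i) w)) @^-1` B i).
  by apply: eq_bigr => i _; rewrite Cr.
exact.
Qed.
End unit_square.

Section link_events.
Local Open Scope ereal_scope.

Lemma measurable_tdiff2 {R : realType} (F : set (R * R)) : measurable F ->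
  measurable [set z : (R * R) * (R * R) | F (tdiff z.1.1 z.2.1, tdiff z.1.2 z.2.2)].
Proof.
move=> mF; rewrite -[X in measurable X]setTI.
have m : measurable_fun setT (fun z : (R * R) * (R * R) => (tdiff z.1.1 z.2.1, tdiff z.1.2 z.2.2)).
  by apply: measurable_fun_pair; apply: measurable_tdiff; apply: measurableT_comp.
exact: m.
Qed.

Lemma square_prob_unit_square {R : realType} :
  square_prob (`[0%R, 1%R] `*` `[0%R, 1%R] : set (R * R)) = 1.
Proof.
have E : uniform_prob (@ltr01 R) `[0%R, 1%R] = 1.
  by rewrite uniform_prob01E// setIid lebesgue_measure_itv/= lte_fin ltr01 -EFinB subr0.
pose U := [the probability _ R of uniform_prob (@ltr01 R)].
have mI : measurable (`[0%R, 1%R]%classic : set (measurableTypeR R)) by exact: measurable_itv.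
have H := product_measure1E U U mI mI.
apply: (etrans H); rewrite /U /=.
by rewrite E mul1e.
Qed.

(** Rotation invariance in the form asked for by [indep_common_source]; the exceptional set is the
    complement of the unit square. *)
Lemma square_prob_section {R : realType} (F : set (R * R)) : measurable F ->
  {ae square_prob, forall z : R * R,
    square_prob (xsection [set z : (R * R) * (R * R) | F (tdiff z.1.1 z.2.1, tdiff z.1.2 z.2.2)] z) =
    square_prob [set p : R * R | F (tdiff 0%R p.1, tdiff 0%R p.2)]}.
Proof.
move=> mF; exists (~` (`[0%R, 1%R] `*` `[0%R, 1%R])).
have mI : measurable (`[0%R, 1%R] `*` `[0%R, 1%R] : set (R * R)) by exact: measurableX.
split.
- exact: measurableC.
- have H := probability_setC square_prob mI.
  apply: (etrans H); rewrite square_prob_unit_square.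
  by rewrite subee.
- move=> [x y] /= h [x01 y01]; apply: h.
  rewrite /= !in_itv/= in x01 y01.
  have := square_prob_tdiff x y F x01 y01 mF.
  by rewrite xsectionE.
Qed.

(** The source is the common variable of [indep_common_source], the relays are the others. Relays
    outside [J] receive the full event, of probability 1, which yields all the intersections that
    the Chernoff bound expands over. *)
Lemma indep_link_events {d} {T : measurableType d} {R : realType} (P : probability T R)
    (X Y : nat -> T -> R) (l m n : nat) (F : set (R * R)) : (l + 1 + m <= n)%N ->
  (forall i, (i < n)%N -> uniform01 P (X i) /\ uniform01 P (Y i)) ->
  mutually_indep P n X Y -> measurable F ->
  forall J : {set 'I_m},
    P (\big[setI/setT]_(i in J)
      [set w | F (tdiff (X src w) (X (relay l i) w), tdiff (Y src w) (Y (relay l i) w))]) =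
    (fine (square_prob [set p : R * R | F (tdiff 0%R p.1, tdiff 0%R p.2)]) ^+ #|J|)%:E.
Proof.
move=> lmn hu hi mF J.
have r_lt (i : nat) : (i < m)%N -> (relay l i < n)%N.
  by move=> im; apply: leq_trans lmn; rewrite /relay ltn_add2l.
have s_lt : (src < n)%N by apply: leq_trans lmn; rewrite /src addn1.
have mXY i : (i < n)%N -> measurable_fun setT (fun w => (X i w, Y i w)).
  by move=> /hu[[? _] [? _]]; exact: measurable_fun_pair.
set D := [set z : (R * R) * (R * R) | F (tdiff z.1.1 z.2.1, tdiff z.1.2 z.2.2)].
set p := square_prob _.
have mD : measurable D by exact: measurable_tdiff2.
have mF0 := measurable_tdiff_pair 0%R 0%R F mF.
have pfin : p \is a fin_num by rewrite /p; exact: fin_num_measure.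
(* Membership in [J] is extended to all naturals, since the families [D'] and [p'] are indexed by
   [nat]. *)
pose inJ i := [exists j : 'I_m, (j \in J) && (j == i :> nat)].
have inJE (i : 'I_m) : inJ i = (i \in J).
  apply/existsP/idP => [[j /andP[jJ /eqP/val_inj <-]]//|iJ].
  by exists i; rewrite iJ eqxx.
pose D' i := if inJ i then D else setT.
pose p' i := if inJ i then p else 1.
have := indep_common_source P square_prob m (fun w => (X src w, Y src w))
  (fun i w => (X (relay l i) w, Y (relay l i) w)) (mXY _ s_lt) (fun i im => mXY _ (r_lt i im))
  (indep_source_relays P X Y l m n lmn hu hi) D' p'.
have mD' i : measurable (D' i) by rewrite /D'; case: ifP.
have aeD' i : {ae square_prob, forall z, square_prob (xsection (D' i) z) = p' i}.
  rewrite /D' /p'; case: ifP => _; first exact: square_prob_section.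
  by apply: nearW => z; rewrite -setXTT in_xsectionX ?inE// probability_setT.
move=> /(_ mD' aeD').
have -> : \prod_(i < m) p' i = (fine p ^+ #|J|)%:E.
  rewrite -prodr_const -prodEFin [RHS]big_mkcond/=; apply: eq_bigr => i _.
  by rewrite /p' inJE; case: ifP => // _; rewrite fineK.
move=> <-; congr (P _); rewrite big_mkcond/=; apply: eq_bigr => i _.
by rewrite /D' inJE; case: ifP => // _; rewrite preimage_setT.
Qed.

End link_events.

(** * The regimes [gam > 0] and [gam = 0] of the network *)

Theorem theorem2 (R : realType) (L : R -> R) (N0 beta gam P0 Rc theta : R) (l : nat)
  (HLcont : {within [set x : R | 0 <= x], continuous L})
  (HLdec : forall a b : R, 0 <= a -> a < b -> L b < L a)
  (HLrange : forall a : R, 0 <= a -> 0 <= L a <= 1)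
  (HN0 : 0 < N0) (Hbeta : 0 < beta) (Hgam : 0 <= gam <= 1)
  (HP0 : beta * N0 < P0) (HR : 0 < Rc <= 1) (Htheta : 0 < theta) (Hl : (0 < l)%N) :
  exists K : R, exists M : nat, forall m : nat, (M <= m)%N ->
  exists Nn : nat, forall n : nat, (Nn <= n)%N -> (l + 1 + m <= n)%N ->
  forall (d : measure_display) (T : measurableType d) (P : probability T R)
         (X Y : nat -> T -> R),
    (forall i, (i < n)%N -> uniform01 P (X i) /\ uniform01 P (Y i)) ->
    mutually_indep P n X Y ->
    let EC0 := fine ('E_P[fun w => C0 L N0 P0 gam beta Rc n l m (X^~ w) (Y^~ w)])%E in
    let eps := Num.sqrt (3 * theta * ln (m%:R) / EC0) in
    (P [set w | (CsT L N0 P0 gam beta Rc n l m (X^~ w) (Y^~ w) <= (1 + eps) * EC0)%R]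
       >= (1 - K / (m%:R `^ theta))%:E)%E.
Proof.
have P00 : 0 < P0 by apply: lt_trans HP0; rewrite mulr_gt0.
have HNP : 0 < N0 / P0 by rewrite divr_gt0.
(* Strict decrease puts [L 1] above [L 2], which is nonnegative. *)
have L1 : 0 < L 1.
  have /andP[L2 _] := HLrange 2 (ler0n R 2).
  by apply: le_lt_trans L2 _; apply: HLdec => //; rewrite ltr1n.
have [gam0|gam0] := eqVneq gam 0; last first.
  have g0 : 0 < gam by rewrite lt_neqAle eq_sym gam0; case/andP: Hgam.
  pose z := beta * (gam * L 1).
  have z0 : 0 < z by rewrite !mulr_gt0.
  (* The bound exceeds [z^-1], and the two extra units make up for the endpoints of the link, so
     [(n - 2) * z > 1]. *)
  exists 1, 0%N => m _; exists ((Num.bound z^-1).+2) => n hn lmn d T P X Y hu hi.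
  cbv zeta.
  set EC0 := fine _; set eps := Num.sqrt _.
  have mXY k : (k < n)%N -> measurable_fun setT (X k) /\ measurable_fun setT (Y k).
    by move=> /hu[[? _] [? _]].
  have EC00 : 0 <= EC0.
    apply: fine_ge0; rewrite unlock; apply: integral_ge0 => w _.
    by rewrite lee_fin; apply: sumr_ge0 => i _; exact: cap_ge0.
  have hz : 1 < beta * (gam * (L 1 * (n - 2)%:R)).
    rewrite mulrA mulrA -(mulrA beta) -/z -ltr_pdivrMl// mulr1.
    apply: lt_le_trans (archi_boundP _) _; first by rewrite invr_ge0 ltW.
    by rewrite ler_nat leq_subRL ?(leq_trans _ hn)// add2n.
  (* On the unit square [C0] vanishes, and the threshold is nonnegative since [EC0] and [eps]
     are. *)
  have sub : \big[setI/setT]_(i < n) (X i @^-1` `[0%R, 1%R] `&` Y i @^-1` `[0%R, 1%R]) `<=`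
      [set w | (CsT L N0 P0 gam beta Rc n l m (X^~ w) (Y^~ w) <= (1 + eps) * EC0)%R].
    move=> w; rewrite -(bigcap_mkord n (fun i => X i @^-1` `[0%R, 1%R] `&` Y i @^-1` `[0%R, 1%R])) => hw /=.
    apply: (le_trans (CsT_le_C0 L N0 P0 gam beta Rc n l m _ _)).
    rewrite (C0_eq0 L N0 P0 gam beta Rc HLrange HNP Hgam n l m)//.
    by rewrite mulr_ge0// addr_ge0// sqrtr_ge0.
  apply: (@le_trans _ _ 1%E).
    by rewrite lee_fin gerBl// divr_ge0// powR_ge0.
  rewrite -(uniform_in_square P X Y n hu hi); apply: le_measure => //; rewrite inE.
    apply: bigsetI_measurable => i _; have [mX mY] := mXY i (ltn_ord i).
    by apply: measurableI; rewrite -[X in measurable X]setTI; [apply: mX|apply: mY].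
  apply: measurable_is_true; apply: measurable_fun_ler => //.
  exact: (measurable_CsT L N0 P0 gam beta Rc HLcont HLrange HNP Hgam).
subst gam.
(* With [gam = 0] a link depends only on its own two endpoints; [F] collects the pairs of coordinate
   distances for which it is up. *)
pose F := [set q : R * R | beta <= L (Num.sqrt (q.1 ^+ 2 + q.2 ^+ 2)) / (N0 / P0)].
have mF : measurable F by exact: measurable_link.
pose p := fine (square_prob [set q : R * R | F (tdiff 0%R q.1, tdiff 0%R q.2)]).
have p0 : 0 <= p by apply: fine_ge0; exact: measure_ge0.
(* This is the threshold of [log_ratio_small] at [a = Rc * p], and the two extra units ensure
   [1 < m]. As [p] is defined from [square_prob], it is fixed before [m], [n] and the probability
   space. *)
exists 1, (Num.bound ((600 * theta / (Rc * p)) ^+ 2)).+2 => m hm.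
exists 0%N => n _ lmn d T P X Y hu hi.
cbv zeta.
have mXY k : (k < n)%N -> measurable_fun setT (X k) /\ measurable_fun setT (Y k).
  by move=> /hu[[? _] [? _]].
pose E (i : 'I_m) := [set w | F (tdiff (X src w) (X (relay l i) w), tdiff (Y src w) (Y (relay l i) w))].
have PE := indep_link_events P X Y l m n F lmn hu hi mF.
have C0E w : C0 L N0 P0 0 beta Rc n l m (X^~ w) (Y^~ w) = Rc * \sum_(i < m) \1_(E i) w.
  rewrite /C0 mulr_sumr; apply: eq_bigr => i _.
  rewrite /cap /sinr mul0r addr0 indicE.
  rewrite (_ : (w \in E i) = (beta <= L (tdist (X^~ w) (Y^~ w) src (relay l i)) / (N0 / P0))).
    by case: ifP; rewrite ?mulr1 ?mulr0.
  by apply/idP/idP; rewrite inE.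
have mE i : measurable (E i).
  have [mX0 mY0] := mXY src (leq_trans (leq_addl l 1) (leq_trans (leq_addr m _) lmn)).
  have [mXi mYi] : measurable_fun setT (X (relay l i)) /\ measurable_fun setT (Y (relay l i)).
    by apply: mXY; apply: leq_trans lmn; rewrite /relay ltn_add2l.
  rewrite -[X in measurable X]setTI.
  have mp : measurable_fun setT (fun w => (tdiff (X src w) (X (relay l i) w), tdiff (Y src w) (Y (relay l i) w))).
    by apply: measurable_fun_pair; exact: measurable_tdiff.
  exact: mp.
have /andP[Rc0 Rc1] := HR.
have PE1 i : P (E i) = p%:E.
  by have := PE [set i]%SET; rewrite big_set1 cards1 expr1.
have EC0E : ('E_P[fun w => C0 L N0 P0 0 beta Rc n l m (X^~ w) (Y^~ w)] = (Rc * (m%:R * p))%:E)%E.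
  rewrite (_ : (fun w => _) = (fun w => Rc * \sum_(i < m) \1_(E i) w)%R); last exact/funext.
  by apply: expectation_sum_indic => //; exact: ltW.
rewrite EC0E /=.
set mu := Rc * (m%:R * p); set eps := Num.sqrt _.
have mX : measurable_fun setT (fun w => \sum_(i < m) \1_(E i) w : R).
  by apply: measurable_sum => i; exact: measurable_indic.
have mlt : measurable [set w | (1 + eps) * mu < Rc * \sum_(i < m) \1_(E i) w].
  by apply: measurable_is_true; apply: measurable_fun_ltr => //; exact: measurable_funM.
have tail := binomial_upper_tail P m E p Rc theta mu eps erefl erefl
  (leq_trans (isT : (1 < (Num.bound ((600 * theta / (Rc * p)) ^+ 2)).+2)%N) hm) p0 HR Htheta.
have hp : 0 < p -> 3 * theta * ln m%:R / (Rc * (m%:R * p)) <= 1 / 100.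
  move=> pp; rewrite [m%:R * p]mulrC mulrA; apply: log_ratio_small => //; first exact: mulr_gt0.
  apply: lt_le_trans (archi_boundP _) _; first exact: sqr_ge0.
  by rewrite ler_nat (leq_trans _ hm)//; apply: leqW; exact: leqnSn.
have {}tail := tail hp mE PE.
(* Off the tail event, [CsT <= C0 <= (1 + eps) * mu]. *)
apply: (@le_trans _ _ (P (~` [set w | (1 + eps) * mu < Rc * \sum_(i < m) \1_(E i) w]))).
  by rewrite probability_setC// EFinB leeB.
apply: le_measure; rewrite ?inE.
- exact: measurableC.
- apply: measurable_is_true; apply: measurable_fun_ler => //.
  exact: (measurable_CsT L N0 P0 0 beta Rc HLcont HLrange HNP Hgam).
- move=> w /= /negP; rewrite -leNgt => h.
  by apply: (le_trans (CsT_le_C0 L N0 P0 0 beta Rc n l m _ _)); rewrite C0E.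
Qed.
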